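(* Let $0<q<1$. For a positive integer $k$ and $i=1,2,\ldots,k$, let $x_i\in(0,\frac12]$ and let $x_i'=1-x_i$. Let $A_k$ denote the arithmetic mean of $x_1,\ldots,x_k$ and let $A_k'$ denote the arithmetic mean of $x_1',\ldots,x_k'$. Then $$\text{(a)}\quad \Gamma_q\left(\frac{A_k'}{A_k}\right)\leq\left(\prod_{i=1}^k\Gamma_q\left(\frac{x_i'}{x_i}\right)\right)^{\frac1k},$$ $$\text{(b)}\quad \frac{\Gamma_q(A_k')}{\Gamma_q(A_k)}\geq\left(\prod_{i=1}^k\frac{\Gamma_q(x_i')}{\Gamma_q(x_i)}\right)^{\frac1k}.$$
   Context: For $0<q<1$ and complex $a$, $(a;q)_\infty=\prod_{i=0}^{\infty}(1-aq^i)$. For real $x>0$, the $q$-gamma function is $\Gamma_q(x)=\frac{(q;q)_\infty}{(q^x;q)_\infty}(1-q)^{1-x}$. *)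

(* Defs.v *)
From HB Require Import structures.
From mathcomp Require Import all_boot all_order all_algebra.
From mathcomp Require Import all_classical all_reals all_analysis.
Set Implicit Arguments.
Unset Strict Implicit.
Unset Printing Implicit Defensive.
Import Order.TTheory GRing.Theory Num.Theory.
Import numFieldNormedType.Exports.
Local Open Scope classical_set_scope.
Local Open Scope ring_scope.

(** [K] is any numeric field, so that both real and complex [a] are covered.
    For [0 < q < 1] and [K] complete the partial products converge, so [limn]
    is the genuine infinite product. *)
Definition qpochhammer (K : numFieldType) (a q : K) : K :=
  limn (fun n : nat => \prod_(0 <= i < n) (1 - a * q ^+ i) : K).

(** Meaningful for [0 < q < 1] and [0 < x] only. *)
Definition qGamma (R : realType) (q x : R) : R :=
  qpochhammer q q / qpochhammer (q `^ x) q * (1 - q) `^ (1 - x).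

Definition amean (R : realType) (k : nat) (x : 'I_k -> R) : R :=
  (\sum_(i < k) x i) / k%:R.

(* Main.v *)
Require Import Defs.
From HB Require Import structures.
From mathcomp Require Import all_boot all_order all_algebra.
From mathcomp Require Import all_classical all_reals all_analysis.
From mathcomp Require Import ring lra.
Import Order.TTheory GRing.Theory Num.Theory.
Import numFieldNormedType.Exports.
Local Open Scope ring_scope.

(** Both inequalities say that a function on (0, 1/2] satisfies Jensen's
    inequality: ln Gamma_q(1/x - 1) for the first, and
    ln Gamma_q(x) - ln Gamma_q(1 - x) for the second.  Indeed A' = 1 - A, so
    A' / A = 1 / A - 1, and taking logarithms turns geometric means into
    arithmetic means.

    Put h(t) = ln (1 - q^t).  The telescoping identity
    - ln (1 - q) = sum_n (h(n+2) - h(n+1)) turns the product defining Gamma_q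
    into a q-analogue of Euler's product,
      ln Gamma_q(y)
        = sum_n [h(n+1) - h(n+y) + (y - 1) (h(n+2) - h(n+1))],
    which is [ln_qGamma_cvg].  Jensen's inequality survives sums and limits
    ([jensen_sum], [jensen_lim]), so it is enough to prove it for one term, and
    for this only h'' <= 0 and h'' nondecreasing matter
    ([ln_one_sub_exp_third_ge0]).

    For the second function the term has derivative
    2 (h(n+2) - h(n+1)) - h'(n+x) - h'(n+1-x), whose own derivative
    h''(n+1-x) - h''(n+x) is nonnegative because x <= 1 - x
    ([euler_term_refl_jensen]).

    For the first function write t = n - 1 + 1/x and D = h(n+2) - h(n+1).  The
    second derivative of the term has the sign of 2 (D - h'(t)) - h''(t) / x.
    As h' is convex, D, the integral of h' over [n+1, n+2], is at least the
    integral of the tangent of h' at t ([unit_increment_ge]), that is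
    h'(t) + (5/2 - 1/x) h''(t).  The expression is thus at least
    (5 - 3/x) h''(t), which is nonnegative as x <= 1/2 and h'' <= 0
    ([euler_term_inv_jensen]). *)

Set Implicit Arguments.
Unset Strict Implicit.

(** * Jensen's inequality from a monotone derivative *)

Lemma mvt_in (R : realType) (i : interval R) (f g : R -> R) :
  {in i, forall z : R, is_derive z 1 f (g z)} ->
  {in i &, forall x y, x <= y ->
    exists2 c, x <= c <= y & f y - f x = g c * (y - x)}.
Proof.
move=> df x y xi yi xy.
have sub z : z \in `[x, y] -> z \in i.
  by rewrite in_itv /= => /(interval_is_interval xi yi); apply.
have [c cxy fE] : exists2 c, c \in `[x, y] & f y - f x = g c * (y - x).
  apply: MVT_segment => // [z zxy|].
    by apply: df; apply: sub; exact: subset_itv_oo_cc.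
  by apply: derivable_within_continuous => z /sub/df [].
by exists c => //; move: cxy; rewrite in_itv.
Qed.

Lemma homo_of_derive_ge0 (R : realType) (i : interval R) (f g : R -> R) :
  {in i, forall z : R, is_derive z 1 f (g z)} -> {in i, forall z, 0 <= g z} ->
  {in i &, {homo f : x y / x <= y}}.
Proof.
move=> df g0 x y xi yi xy; have [c cxy fE] := mvt_in df xi yi xy.
rewrite -subr_ge0 fE mulr_ge0 ?subr_ge0 // g0 //.
exact: interval_is_interval xi yi _ cxy.
Qed.

Lemma tangent_le (R : realType) (i : interval R) (f g : R -> R) :
  {in i, forall z : R, is_derive z 1 f (g z)} ->
  {in i &, {homo g : x y / x <= y}} ->
  {in i &, forall x y, f x + g x * (y - x) <= f y}.
Proof.
move=> df gm x y xi yi; rewrite -lerBrDl; have [xy|/ltW yx] := leP x y.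
  have [c cxy ->] := mvt_in df xi yi xy.
  rewrite ler_wpM2r ?subr_ge0 // gm //; last by case/andP: cxy.
  exact: interval_is_interval xi yi _ cxy.
have [c cxy fE] := mvt_in df yi xi yx.
rewrite -(opprB (f x)) fE -mulrN opprB ler_wnM2r ?subr_le0 // gm //.
  exact: interval_is_interval yi xi _ cxy.
by case/andP: cxy.
Qed.

(** Convexity in the form with k equal weights: this is the form in which it is
    used, and its closure under sums and pointwise limits is immediate. *)
Definition jensen_on (R : realType) (i : interval R) (f : R -> R) :=
  forall (k : nat) (x : 'I_k -> R), (0 < k)%N -> (forall j, x j \in i) ->
    f (amean x) <= amean (fun j => f (x j)).

Lemma amean_itv (R : realType) (a b : R) (k : nat) (x : 'I_k -> R) :
  (0 < k)%N -> (forall j, x j \in `]a, b]) -> amean x \in `]a, b].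
Proof.
move=> k0 xi; have k0' : 0 < k%:R :> R by rewrite ltr0n.
rewrite in_itv /= /amean ltr_pdivlMr // ler_pdivrMr //.
have cE c : c * k%:R = \sum_(i < k) c :> R by rewrite sumr_const card_ord mulr_natr.
rewrite !cE; apply/andP; split; last first.
  by apply: ler_sum => j _; move: (xi j); rewrite in_itv /= => /andP[].
apply: ltr_sum; first by apply/hasP; exists (Ordinal k0); rewrite ?mem_index_enum.
by move=> j _; move: (xi j); rewrite in_itv /= => /andP[].
Qed.

(** Summing the tangent inequality at the mean over the k points cancels the
    linear terms. *)
Lemma jensen_of_derive (R : realType) (a b : R) (f g : R -> R) :
  {in `]a, b], forall z : R, is_derive z 1 f (g z)} ->
  {in `]a, b] &, {homo g : x y / x <= y}} -> jensen_on `]a, b] f.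
Proof.
move=> df gm k x k0 xi; have k0' : 0 < k%:R :> R by rewrite ltr0n.
set m := amean x; have mi : m \in `]a, b] by exact: amean_itv.
rewrite [leRHS]/amean ler_pdivlMr //.
have -> : f m * k%:R = \sum_(j < k) (f m + g m * (x j - m)).
  rewrite big_split /= -mulr_sumr big_split /= !sumr_const card_ord.
  rewrite -[\sum_(i < k) x i](@divfK _ k%:R) ?gt_eqF // -/(amean x) -/m.
  by rewrite mulNrn (mulr_natr m) subrr mulr0 addr0 mulr_natr.
by apply: ler_sum => j _; apply: (tangent_le df gm).
Qed.

Lemma jensen_sum (R : realType) (i : interval R) (f : nat -> R -> R) (N : nat) :
  (forall n, jensen_on i (f n)) ->
  jensen_on i (fun t => \sum_(0 <= n < N) f n t).
Proof.
move=> fJ k x k0 xi; rewrite [leRHS]/amean exchange_big /= mulr_suml.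
by apply: ler_sum => n _; exact: fJ.
Qed.

Lemma jensen_lim (R : realType) (a b : R) (f : nat -> R -> R) (g : R -> R) :
  (forall n, jensen_on `]a, b] (f n)) ->
  {in `]a, b], forall t, (f n t @[n --> \oo] --> g t)%classic} ->
  jensen_on `]a, b] g.
Proof.
move=> fJ fg k x k0 xi.
apply: (@ler_cvg_to _ \oo%classic _ _ (fun n => f n (amean x))
  (fun n => amean (fun j => f n (x j)))).
- by apply: fg; exact: amean_itv.
- rewrite /amean; apply: cvgM; last exact: cvg_cst.
  apply: cvg_big => [|j _]; [exact: add_continuous|exact: fg].
- by apply: nearW => n; exact: fJ.
Qed.

(** * Derivatives of explicit expressions *)

Lemma is_derive_comp_fun (R : realType) (f g : R -> R) (x y a b : R) :
  is_derive y 1 f a -> y = g x -> is_derive x 1 g b ->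
  is_derive x 1 (fun z => f (g z)) (a * b).
Proof. by move=> dfy yE; rewrite yE in dfy; exact: is_derive1_comp. Qed.

Lemma is_derive_add_fun (R : realType) (f g : R -> R) (x a b : R) :
  is_derive x 1 f a -> is_derive x 1 g b ->
  is_derive x 1 (fun z => f z + g z) (a + b).
Proof. exact: is_deriveD. Qed.

Lemma is_derive_opp_fun (R : realType) (f : R -> R) (x a : R) :
  is_derive x 1 f a -> is_derive x 1 (fun z => - f z) (- a).
Proof. exact: is_deriveN. Qed.

Lemma is_derive_mul_fun (R : realType) (f g : R -> R) (x a b : R) :
  is_derive x 1 f a -> is_derive x 1 g b ->
  is_derive x 1 (fun z => f z * g z) (f x * b + g x * a).
Proof. exact: is_deriveM. Qed.

(** Differentiates an explicit expression and leaves the equality between the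
    computed derivative and the stated one.  Composition with a function whose
    derivative is an assumption comes before the algebraic rules, so that such
    a function is not unfolded. *)
Ltac derive_fun :=
  notypeclasses refine (@is_derive_eq _ _ _ _ _ _ _ _ _ _);
  [ repeat first
      [ notypeclasses refine (is_derive_cst _ _ _)
      | notypeclasses refine (is_derive_id _ _)
      | match goal with H : is_derive _ _ _ _ |- _ => exact H end
      | match goal with H : is_derive _ _ _ _ |- _ =>
          notypeclasses refine (is_derive_comp_fun H _ _); [reflexivity|] end
      | notypeclasses refine (is_derive_opp_fun _)
      | notypeclasses refine (is_derive_add_fun _ _)
      | notypeclasses refine (is_derive_mul_fun _ _) ]
  | rewrite /= ?/GRing.scale /= ].

(** * Convexity of the terms of Euler's product *)

(** A nonnegative third derivative of h is encoded as the monotonicity of its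
    second derivative r, which is the convexity of p = h'. *)
Definition concave_third_ge0 (R : realType) (h p r : R -> R) :=
  [/\ {in `]0, +oo[, forall t : R, is_derive t 1 h (p t)},
      {in `]0, +oo[, forall t : R, is_derive t 1 p (r t)},
      {in `]0, +oo[ &, {homo r : s t / s <= t}} &
      {in `]0, +oo[, forall t : R, r t <= 0}].

(** For h = ln this is the n-th term of the logarithm of Euler's product for the
    gamma function; its q-analogue has h(t) = ln (1 - q^t). *)
Definition euler_term (R : realType) (h : R -> R) (n : nat) (y : R) : R :=
  h n.+1%:R - h (n%:R + y) + (y - 1) * (h n.+2%:R - h n.+1%:R).

Lemma gt0_itv (R : realType) (t : R) : (t \in `]0, +oo[) = (0 < t).
Proof. by rewrite in_itv /= andbT. Qed.

(** The tangent of the convex function p at t lies below p; integrating this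
    over [m, m + 1] gives the bound.  The integration is done by the function
    l below, the difference of the two primitives, which is nondecreasing. *)
Lemma unit_increment_ge (R : realType) (h p r : R -> R) (m t : R) :
  concave_third_ge0 h p r -> 0 < m -> 0 < t ->
  p t + (m + 2^-1 - t) * r t <= h (m + 1) - h m.
Proof.
move=> [dh dp rm _] m0 t0.
pose l u := h u - p t * u - r t * 2^-1 * ((u - t) * (u - t)).
have dl : {in `]0, +oo[, forall u : R,
    is_derive u 1 l (p u - p t - r t * (u - t))}.
  move=> u u0; have hu := dh u u0.
  by rewrite /l; derive_fun; lra.
have l_le : l m <= l (m + 1).
  apply: (homo_of_derive_ge0 dl); rewrite ?gt0_itv ?addr_gt0 ?lerDl //.
  move=> u u0; have := tangent_le dp rm (x := t) (y := u).
  by rewrite gt0_itv t0 u0 => /(_ isT isT); lra.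
move: l_le; rewrite /l; lra.
Qed.

Lemma euler_term_derive (R : realType) (h p r : R -> R) (n : nat) (y : R) :
  concave_third_ge0 h p r -> 0 < y ->
  is_derive y 1 (euler_term h n)
    (h n.+2%:R - h n.+1%:R - p (n%:R + y)).
Proof.
move=> [dh _ _ _] y0.
have hny : is_derive (n%:R + y) 1 h (p (n%:R + y)).
  by apply: dh; rewrite gt0_itv ltr_wpDl.
by rewrite /euler_term; derive_fun; ring.
Qed.

(** With t = n - 1 + 1/x, the second derivative in x is
    x^-3 (2 (D - p t) - r t / x), and the tangent bound for D makes the bracket
    at least (5 - 3/x) r t >= 0. *)
Lemma euler_term_inv_jensen (R : realType) (h p r : R -> R) (n : nat) :
  concave_third_ge0 h p r ->
  jensen_on `]0, 2^-1] (fun x => euler_term h n (x^-1 - 1)).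
Proof.
move=> hpr; have [dh dp rm r0] := hpr.
pose D := h n.+2%:R - h n.+1%:R; pose t x : R := n%:R + (x^-1 - 1).
have itv_gt0 (x : R) : x \in `]0, 2^-1] -> 0 < x /\ 2 <= x^-1.
  rewrite in_itv /= => /andP[x0 xh]; split => //.
  by rewrite -[leLHS]invrK lef_pV2 ?posrE ?invr_gt0.
have t0 x : x \in `]0, 2^-1] -> 0 < t x.
  by move=> /itv_gt0[_ x2]; rewrite /t ltr_wpDl // subr_gt0; lra.
have dV (x : R) : 0 < x -> is_derive x (1 : R) (fun z => z^-1) (- (x^-1 * x^-1)).
  move=> x0; have : id x != 0 by rewrite gt_eqF.
  move=> nz; apply: (is_derive_eq (is_deriveV nz (is_derive_id x 1))).
  by rewrite /GRing.scale /= mulr1 -exprVn expr2.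
apply: (@jensen_of_derive _ _ _ _ (fun x => (x^-1 * x^-1) * (p (t x) - D))).
  move=> x xi; have [x0 x2] := itv_gt0 x xi; have dx := dV x x0.
  have dE : is_derive (x^-1 - 1) 1 (euler_term h n) (D - p (t x)).
    by apply: (euler_term_derive n hpr); lra.
  by derive_fun; rewrite -/D -/(t x); ring.
apply: (@homo_of_derive_ge0 _ _ _
  (fun x => x^-1 * x^-1 * x^-1 * (2 * (D - p (t x)) - x^-1 * r (t x)))).
  move=> x xi; have [x0 x2] := itv_gt0 x xi; have dx := dV x x0.
  have dE : is_derive (t x) 1 p (r (t x)) by apply: dp; rewrite gt0_itv t0.
  by rewrite /t; derive_fun; rewrite -/(t x); ring.
move=> x xi; have [x0 x2] := itv_gt0 x xi.
rewrite mulr_ge0 ?mulr_ge0 ?invr_ge0 ?(ltW x0) //.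
have := @unit_increment_ge _ _ _ _ n.+1%:R (t x) hpr (ltr0Sn _ _) (t0 x xi).
have -> : n.+1%:R + 1 = n.+2%:R :> R by rewrite natr1.
rewrite -/D => Dge.
(* The lower bound (5 - 3/x) r is - r - 3 (1/x - 2) r. *)
have r_le : (x^-1 - 2) * r (t x) <= 0.
  by rewrite mulr_ge0_le0 ?subr_ge0 // r0 // gt0_itv t0.
have r_le0 : r (t x) <= 0 by rewrite r0 // gt0_itv t0.
have tE : n.+1%:R - t x = 2 - x^-1 by rewrite /t -natr1; lra.
have : p (t x) + (2 - x^-1 + 2^-1) * r (t x) <= D.
  by rewrite -tE; apply: le_trans Dge; lra.
lra.
Qed.

(** The second derivative in x is r (n + (1 - x)) - r (n + x), and x <= 1 - x
    on this interval. *)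
Lemma euler_term_refl_jensen (R : realType) (h p r : R -> R) (n : nat) :
  concave_third_ge0 h p r ->
  jensen_on `]0, 2^-1] (fun x => euler_term h n x - euler_term h n (1 - x)).
Proof.
move=> hpr; have [dh dp rm r0] := hpr.
pose D := h n.+2%:R - h n.+1%:R.
have itv_gt0 (x : R) : x \in `]0, 2^-1] -> [/\ 0 < x, 0 < 1 - x & x <= 1 - x].
  by rewrite in_itv /= => /andP[x0 xh]; split; lra.
apply: (@jensen_of_derive _ _ _ _
  (fun x => (D - p (n%:R + x)) + (D - p (n%:R + (1 - x))))).
  move=> x /itv_gt0[x0 x1 _].
  have d0 := euler_term_derive n hpr x0; have d1 := euler_term_derive n hpr x1.
  by derive_fun; rewrite -/D; ring.
apply: (@homo_of_derive_ge0 _ _ _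
  (fun x => r (n%:R + (1 - x)) - r (n%:R + x))).
  move=> x /itv_gt0[x0 x1 _].
  have d0 : is_derive (n%:R + x) 1 p (r (n%:R + x)).
    by apply: dp; rewrite gt0_itv ltr_wpDl.
  have d1 : is_derive (n%:R + (1 - x)) 1 p (r (n%:R + (1 - x))).
    by apply: dp; rewrite gt0_itv ltr_wpDl.
  by derive_fun; ring.
move=> x /itv_gt0[x0 x1 x2]; rewrite subr_ge0; apply: rm.
- by rewrite gt0_itv ltr_wpDl.
- by rewrite gt0_itv ltr_wpDl.
- by rewrite lerD2l.
Qed.

(** For u = exp (t l), which decreases in t, the second derivative is
    - l^2 u / (1 - u)^2, and u / (1 - u)^2 increases in u. *)
Lemma ln_one_sub_exp_third_ge0 (R : realType) (l : R) : l < 0 ->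
  concave_third_ge0 (fun t => ln (1 - expR (t * l)))
    (fun t => - (l * expR (t * l)) * (1 - expR (t * l))^-1)
    (fun t => - (l * l) *
      (expR (t * l) * ((1 - expR (t * l))^-1 * (1 - expR (t * l))^-1))).
Proof.
move=> l0.
have u0 (t : R) : 0 < t -> 0 < 1 - expR (t * l).
  by move=> t0; rewrite subr_gt0 expR_lt1 pmulr_rlt0.
have du (t : R) : is_derive t 1 (fun t => expR (t * l)) (l * expR (t * l)).
  by have de := is_derive_expR (t * l); derive_fun; ring.
have du1 (t : R) :
    is_derive t 1 (fun t => 1 - expR (t * l)) (- (l * expR (t * l))).
  by have dt := du t; derive_fun; ring.
split.
- move=> t; rewrite gt0_itv => /u0 t1; have dt := du1 t.
  by have dl := is_derive1_ln t1; derive_fun; ring.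
- move=> t; rewrite gt0_itv => /u0 t1; have dt := du t.
  have dV := is_deriveV (f := fun t => 1 - expR (t * l)) (lt0r_neq0 t1) (du1 t).
  derive_fun; rewrite -exprVn.
  have : 1 - expR (t * l) != 0 by rewrite lt0r_neq0.
  by move: (expR _) => e e1; field.
- move=> s t; rewrite !gt0_itv => s0 t0 st.
  have est : expR (t * l) <= expR (s * l) by rewrite ler_expR ler_wnM2r // ltW.
  rewrite ler_wnM2l ?oppr_le0 ?sqr_ge0 // ?mulr_le0 ?(ltW l0) //.
  have ? := u0 _ s0; have ? := u0 _ t0.
  have est1 : (1 - expR (t * l))^-1 <= (1 - expR (s * l))^-1.
    by rewrite lef_pV2 ?posrE ?u0 // lerB.
  have ? : 0 <= (1 - expR (t * l))^-1 by rewrite invr_ge0 ltW ?u0.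
  by rewrite !ler_pM ?mulr_ge0 ?expR_ge0.
- move=> t; rewrite gt0_itv => /u0 t1.
  rewrite mulNr oppr_le0 mulr_ge0 -?expr2 ?sqr_ge0 //.
  by rewrite mulr_ge0 ?expR_ge0 ?sqr_ge0.
Qed.

(** * Euler's product for the q-gamma function *)

Lemma expR_le_one_sub (R : realType) (a u : R) :
  0 <= u -> u <= a -> a < 1 -> expR (- (u / (1 - a))) <= 1 - u.
Proof.
move=> u0 ua a1; have a1' : 0 < 1 - a by rewrite subr_gt0.
have u1 : 0 < 1 - u by rewrite subr_gt0 (le_lt_trans ua).
rewrite expRN -[leRHS]invrK lef_pV2 ?posrE ?invr_gt0 ?expR_gt0 //.
apply: le_trans (expR_ge1Dx _).
have -> : (1 - u)^-1 = 1 + u / (1 - u) by field; rewrite lt0r_neq0.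
by rewrite lerD2l ler_wpM2l // lef_pV2 ?posrE // lerB.
Qed.

Lemma geometric_sum_le (R : realType) (q : R) (n : nat) :
  0 <= q -> q < 1 -> \sum_(0 <= i < n) q ^+ i <= (1 - q)^-1.
Proof.
move=> q0 q1; have q1' : 0 < 1 - q by rewrite subr_gt0.
rewrite -[leRHS]mul1r ler_pdivlMr // big_mkord mulrC.
by rewrite -opprB mulNr -subrX1 opprB gerBl exprn_ge0.
Qed.

Lemma qfactor_itv (R : realType) (a q : R) (i : nat) :
  0 <= q -> q < 1 -> 0 <= a -> a < 1 ->
  [/\ 0 <= a * q ^+ i, a * q ^+ i <= a & 0 < 1 - a * q ^+ i].
Proof.
move=> q0 q1 a0 a1; have qi : 0 <= q ^+ i by rewrite exprn_ge0.
have le_a : a * q ^+ i <= a by rewrite ler_piMr // exprn_ile1 // ltW.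
by split; rewrite ?mulr_ge0 // subr_gt0 (le_lt_trans le_a).
Qed.

Lemma qprod_gt0 (R : realType) (a q : R) (n : nat) :
  0 <= q -> q < 1 -> 0 <= a -> a < 1 ->
  0 < \prod_(0 <= i < n) (1 - a * q ^+ i).
Proof.
by move=> q0 q1 a0 a1; apply: prodr_gt0 => i _; case: (qfactor_itv i q0 q1 a0 a1).
Qed.

(** The partial products decrease, and 1 - u >= exp (- u / (1 - a)) for
    u <= a bounds them below by a positive exponential, since the sum of the
    a q^i is bounded by a geometric series. *)
Lemma qpochhammer_cvg_gt0 (R : realType) (a q : R) :
  0 <= q -> q < 1 -> 0 <= a -> a < 1 ->
  (\prod_(0 <= i < n) (1 - a * q ^+ i) @[n --> \oo] --> qpochhammer a q)%classic
  /\ 0 < qpochhammer a q.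
Proof.
move=> q0 q1 a0 a1; pose P n := \prod_(0 <= i < n) (1 - a * q ^+ i).
have P0 n : 0 < P n by exact: qprod_gt0.
have Pdecr : nonincreasing_seq P.
  apply/nonincreasing_seqP => n; rewrite /P big_nat_recr //= -/(P n).
  by rewrite ler_piMr ?(ltW (P0 _)) // gerBl mulr_ge0 ?exprn_ge0.
pose c := expR (- (a / (1 - a) / (1 - q))).
have cP n : c <= P n.
  apply: (@le_trans _ _ (expR (\sum_(0 <= i < n) - (a * q ^+ i / (1 - a))))).
    rewrite ler_expR sumrN lerN2 -mulr_suml -mulr_sumr.
    rewrite (mulrAC a _ (1 - a)^-1) ler_wpM2l ?geometric_sum_le //.
    by rewrite divr_ge0 // subr_ge0 ltW.
  rewrite expR_sum; apply: ler_prod => i _; rewrite expR_ge0 /=.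
  by have [? ? _] := qfactor_itv i q0 q1 a0 a1; exact: expR_le_one_sub.
have Pcvg : cvgn P.
  by apply: nonincreasing_is_cvgn => //; exists 0 => _ [n _ <-]; exact: ltW.
split; first exact: Pcvg.
have : c <= limn P by apply: limr_ge => //; exact: nearW.
by apply: lt_le_trans; exact: expR_gt0.
Qed.

Lemma qpower_expR (R : realType) (q x : R) (n : nat) : 0 < q ->
  expR ((n%:R + x) * ln q) = q `^ x * q ^+ n.
Proof.
move=> q0; rewrite mulrDl expRD mulrC /powR gt_eqF //; congr (_ * _).
by rewrite expRM_natl lnK.
Qed.

Definition ln_qGamma_partial (R : realType) (q : R) (N : nat) (x : R) : R :=
  \sum_(0 <= n < N) euler_term (fun t => ln (1 - expR (t * ln q))) n x.

(** The increments h(n+2) - h(n+1) telescope, which leaves a boundary term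
    ln (1 - q^(N+1)) that vanishes in the limit. *)
Lemma ln_qGamma_partialE (R : realType) (q x : R) (N : nat) :
  0 < q -> q < 1 -> 0 < x ->
  ln_qGamma_partial q N x =
  ln (\prod_(0 <= i < N) (1 - q * q ^+ i))
  - ln (\prod_(0 <= i < N) (1 - q `^ x * q ^+ i))
  + (x - 1) * (ln (1 - q * q ^+ N) - ln (1 - q)).
Proof.
move=> q0 q1 x0.
have q0' := ltW q0; have qx0 := powR_ge0 q x.
have qx1 : q `^ x < 1 by rewrite /powR gt_eqF // expR_lt1 pmulr_rlt0 // ln_lt0 ?q0.
rewrite /ln_qGamma_partial; elim: N => [|N IH].
  by rewrite !big_nil ln1 expr0 mulr1; ring.
rewrite !big_nat_recr //= IH !lnM ?posrE; try exact: qprod_gt0; last first.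
- by case: (qfactor_itv N q0' q1 q0' q1).
- by case: (qfactor_itv N q0' q1 qx0 qx1).
have qE m : expR (m.+1%:R * ln q) = q * q ^+ m by rewrite expRM_natl lnK ?exprS.
rewrite /euler_term qpower_expR // !qE; ring.
Qed.

Lemma ln_qGamma_cvg (R : realType) (q x : R) : 0 < q -> q < 1 -> 0 < x ->
  0 < qGamma q x /\
  (ln_qGamma_partial q N x @[N --> \oo] --> ln (qGamma q x))%classic.
Proof.
move=> q0 q1 x0.
have q0' := ltW q0; have qx0 := powR_ge0 q x.
have qx1 : q `^ x < 1 by rewrite /powR gt_eqF // expR_lt1 pmulr_rlt0 // ln_lt0 ?q0.
have [cq pq] := qpochhammer_cvg_gt0 q0' q1 q0' q1.
have [cx px] := qpochhammer_cvg_gt0 q0' q1 qx0 qx1.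
have q1' : 0 < 1 - q by rewrite subr_gt0.
split; first by rewrite /qGamma !mulr_gt0 ?invr_gt0 ?powR_gt0.
have -> : ln (qGamma q x) = ln (qpochhammer q q) - ln (qpochhammer (q `^ x) q)
    + (x - 1) * (ln (1 - q * 0) - ln (1 - q)).
  rewrite /qGamma lnM ?posrE ?divr_gt0 ?powR_gt0 // ln_div ?posrE // ln_powR.
  by rewrite mulr0 subr0 ln1; ring.
under eq_fun do rewrite ln_qGamma_partialE //.
apply: cvgD.
  by apply: cvgB; apply: continuous_cvg => //; apply: continuous_ln.
apply: cvgM; first exact: cvg_cst.
apply: cvgB; last exact: cvg_cst.
apply: continuous_cvg; first by apply: continuous_ln; rewrite mulr0 subr0.
apply: cvgB; first exact: cvg_cst.
apply: cvgM; first exact: cvg_cst.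
by apply: cvg_expr; rewrite ger0_norm.
Qed.

(** * The two inequalities *)

Lemma prod_powR_inv (R : realType) (k : nat) (G : 'I_k -> R) :
  (forall i, 0 < G i) ->
  (\prod_(i < k) G i) `^ (1 / k%:R) = expR (amean (fun i => ln (G i))).
Proof.
move=> G0; under eq_bigr do rewrite -[G _]lnK ?posrE //.
by rewrite -expR_sum -expRM mul1r.
Qed.

Lemma ln_qGamma_inv_jensen (R : realType) (q : R) : 0 < q -> q < 1 ->
  jensen_on `]0, 2^-1] (fun x => ln (qGamma q (x^-1 - 1))).
Proof.
move=> q0 q1; have l0 : ln q < 0 by rewrite ln_lt0 ?q0.
apply: (jensen_lim (f := fun N x => ln_qGamma_partial q N (x^-1 - 1))) => [N|x xi].
  by apply: jensen_sum => n; apply: euler_term_inv_jensen (ln_one_sub_exp_third_ge0 l0).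
apply: (ln_qGamma_cvg q0 q1 _).2.
have [x0 xh] : 0 < x /\ x <= 2^-1 by move: xi; rewrite in_itv => /andP.
by rewrite subr_gt0 invf_gt1 //; lra.
Qed.

Lemma ln_qGamma_refl_jensen (R : realType) (q : R) : 0 < q -> q < 1 ->
  jensen_on `]0, 2^-1] (fun x => ln (qGamma q x) - ln (qGamma q (1 - x))).
Proof.
move=> q0 q1; have l0 : ln q < 0 by rewrite ln_lt0 ?q0.
apply: (jensen_lim (f := fun N x =>
    ln_qGamma_partial q N x - ln_qGamma_partial q N (1 - x))) => [N|x xi].
  rewrite /ln_qGamma_partial; under eq_fun do rewrite -sumrB.
  apply: (jensen_sum (f := fun n x =>
    euler_term _ n x - euler_term _ n (1 - x))) => n.
  by apply: euler_term_refl_jensen (ln_one_sub_exp_third_ge0 l0).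
have [x0 xh] : 0 < x /\ x <= 2^-1 by move: xi; rewrite in_itv => /andP.
by apply: cvgB; apply: (ln_qGamma_cvg q0 q1 _).2; lra.
Qed.

Unset Implicit Arguments.

Theorem theorem9 (R : realType) (q : R) (hq0 : 0 < q) (hq1 : q < 1)
    (k : nat) (hk : (0 < k)%N) (x x' : 'I_k -> R)
    (hx : forall i : 'I_k, 0 < x i /\ x i <= 1 / 2%:R)
    (hx' : forall i : 'I_k, x' i = 1 - x i) :
  qGamma q (amean x' / amean x)
    <= (\prod_(i < k) qGamma q (x' i / x i)) `^ (1 / k%:R)
  /\
  qGamma q (amean x') / qGamma q (amean x)
    >= (\prod_(i < k) (qGamma q (x' i) / qGamma q (x i))) `^ (1 / k%:R).
Proof.
have G0 y : 0 < y -> 0 < qGamma q y by move=> /(ln_qGamma_cvg hq0 hq1)[].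
have xi i : x i \in `]0, 2^-1].
  by rewrite in_itv /=; have [-> xh] := hx i; rewrite -div1r.
have mi := amean_itv hk xi.
have itvP (t : R) : t \in `]0, 2^-1] -> [/\ 0 < t, 0 < 1 - t & 0 < t^-1 - 1].
  rewrite in_itv /= => /andP[t0 th]; split => //; first by lra.
  by rewrite subr_gt0 invf_gt1 //; lra.
have ratioE (t : R) : t \in `]0, 2^-1] -> (1 - t) / t = t^-1 - 1.
  by move=> /itvP[t0 _ _]; rewrite mulrBl mul1r divff ?gt_eqF.
have x'E : amean x' = 1 - amean x.
  rewrite /amean (eq_bigr _ (fun i _ => hx' i)) sumrB sumr_const card_ord.
  by rewrite mulrBl divff // pnatr_eq0 -lt0n.
have [m0 m1 mV] := itvP _ mi.
split.
- rewrite x'E ratioE // prod_powR_inv => [|i]; last first.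
    by rewrite hx' ratioE // G0 //; case: (itvP _ (xi i)).
  rewrite -[leLHS]lnK ?posrE ?G0 // ler_expR.
  apply: le_trans (ln_qGamma_inv_jensen hq0 hq1 hk xi) _.
  rewrite le_eqVlt; apply/orP; left; apply/eqP; congr (_ / _).
  by apply: eq_bigr => i _; rewrite hx' ratioE.
rewrite x'E prod_powR_inv => [|i]; last first.
  by have [? ? _] := itvP _ (xi i); rewrite hx' divr_gt0 ?G0.
rewrite -[leRHS]lnK ?posrE ?divr_gt0 ?G0 // ler_expR ln_div ?posrE ?G0 //.
rewrite -[leRHS]opprB lerNr.
apply: le_trans (ln_qGamma_refl_jensen hq0 hq1 hk xi) _.
rewrite /amean -mulNr -sumrN ler_wpM2r ?invr_ge0 ?ler0n // le_eqVlt.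
apply/orP; left; apply/eqP; apply: eq_bigr => i _.
have [? ? _] := itvP _ (xi i).
by rewrite hx' ln_div ?posrE ?G0 // opprB.
Qed.
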